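(* Let $Z \in \mathbb{Q}^{3\times 3}$ be a quaternion matrix with $Z \neq O$ which has one of the following two forms, with $b, c \in \mathbb{Q}$: $$\text{(I)}\quad Z = \begin{bmatrix} 0 & 0 & c \\ 0 & 0 & b \\ -c & -b & 0 \end{bmatrix}, \qquad\qquad \text{(II)}\quad Z = \begin{bmatrix} 0 & 1 & c \\ -1 & 0 & b \\ -c & -b & 0 \end{bmatrix}.$$ Let $W = -Z\bar Z = ZZ^*$. Then: (i) If $Z$ is of form (I), or if $Z$ is of form (II) with $\bar b\,\bar c = \bar c\,\bar b$, then $W$ has a zero right eigenvalue and a double positive right eigenvalue. (ii) If $Z$ is of form (II) with $\bar b\,\bar c \neq \bar c\,\bar b$, then $W$ has three positive right eigenvalues (counted with multiplicity). (iii) In the case of (ii) it is possible that the three positive right eigenvalues are distinct from each other; that is, there exist $b, c \in \mathbb{Q}$ with $\bar b\,\bar c \neq \bar c\,\bar b$ such that, for $Z$ of form (II), $W$ has three pairwise distinct positive right eigenvalues.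
   Context: $\mathbb{Q}$ denotes the (noncommutative) real quaternions $q = q_0 + q_1\mathbf{i} + q_2\mathbf{j} + q_3\mathbf{k}$, with $q_0,\dots,q_3 \in \mathbb{R}$, and $\bar q = q_0 - q_1\mathbf{i} - q_2\mathbf{j} - q_3\mathbf{k}$ is the quaternion conjugate. For a quaternion matrix $A = (a_{ij})$, $A^\top = (a_{ji})$ is the transpose, $\bar A = (\bar a_{ij})$ is the entrywise conjugate, and $A^* = (\bar a_{ji}) = \bar A^\top$ is the conjugate transpose. $A$ is Hermitian if $A^* = A$. $O$ is the zero matrix. A quaternion $\lambda$ is a right eigenvalue of $A \in \mathbb{Q}^{n\times n}$ if $A\mathbf{x} = \mathbf{x}\lambda$ for some nonzero $\mathbf{x} \in \mathbb{Q}^n$. A Hermitian $A \in \mathbb{Q}^{n\times n}$ has exactly $n$ real right eigenvalues counted with multiplicity, namely $\lambda_1 \ge \cdots \ge \lambda_n$ such that $U^*AU = \mathrm{diag}(\lambda_1,\dots,\lambda_n)$ for some unitary $U \in \mathbb{Q}^{n\times n}$ (i.e. $U^*U = I$). Right eigenvalues of Hermitian matrices are counted with multiplicity in this sense, and ''double'' means multiplicity two. *)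

(* Defs.v *)
From HB Require Import structures.
From mathcomp Require Import all_boot all_order all_algebra.
From mathcomp Require Import ring.
From mathcomp Require Import reals.

Set Implicit Arguments.
Unset Strict Implicit.
Unset Printing Implicit Defensive.

Import Order.TTheory GRing.Theory Num.Theory.
Local Open Scope ring_scope.

Record quat (R : Type) := Quat { q0 : R; q1 : R; q2 : R; q3 : R }.

Section QuatRing.
Variable R : realType.
Implicit Types p q r : quat R.

Lemma quat_ext p q :
  q0 p = q0 q -> q1 p = q1 q -> q2 p = q2 q -> q3 p = q3 q -> p = q.
Proof. by case: p => ????; case: q => ???? /= -> -> -> ->. Qed.

Definition prod_of_quat q : R * R * R * R := (q0 q, q1 q, q2 q, q3 q).
Definition quat_of_prod (t : R * R * R * R) : quat R :=
  let: (a, b, c, d) := t in Quat a b c d.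
Lemma prod_of_quatK : cancel prod_of_quat quat_of_prod.
Proof. by case. Qed.

HB.instance Definition _ := Choice.copy (quat R) (can_type prod_of_quatK).

Definition addq p q :=
  Quat (q0 p + q0 q) (q1 p + q1 q) (q2 p + q2 q) (q3 p + q3 q).
Definition oppq p := Quat (- q0 p) (- q1 p) (- q2 p) (- q3 p).
Definition realq (a : R) : quat R := Quat a 0 0 0.
Definition mulq p q :=
  Quat (q0 p * q0 q - q1 p * q1 q - q2 p * q2 q - q3 p * q3 q)
       (q0 p * q1 q + q1 p * q0 q + q2 p * q3 q - q3 p * q2 q)
       (q0 p * q2 q - q1 p * q3 q + q2 p * q0 q + q3 p * q1 q)
       (q0 p * q3 q + q1 p * q2 q - q2 p * q1 q + q3 p * q0 q).

Lemma addqA : associative addq.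
Proof. by move=> p q r; apply: quat_ext => /=; ring. Qed.
Lemma addqC : commutative addq.
Proof. by move=> p q; apply: quat_ext => /=; ring. Qed.
Lemma add0q : left_id (realq 0) addq.
Proof. by move=> p; apply: quat_ext => /=; ring. Qed.
Lemma addNq : left_inverse (realq 0) oppq addq.
Proof. by move=> p; apply: quat_ext => /=; ring. Qed.

HB.instance Definition _ := GRing.isZmodule.Build (quat R) addqA addqC add0q addNq.

Lemma mulqA : associative mulq.
Proof. by move=> p q r; apply: quat_ext => /=; ring. Qed.
Lemma mul1q : left_id (realq 1) mulq.
Proof. by move=> p; apply: quat_ext => /=; ring. Qed.
Lemma mulq1 : right_id (realq 1) mulq.
Proof. by move=> p; apply: quat_ext => /=; ring. Qed.
Lemma mulqDl : left_distributive mulq +%R.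
Proof. by move=> p q r; apply: quat_ext => /=; ring. Qed.
Lemma mulqDr : right_distributive mulq +%R.
Proof. by move=> p q r; apply: quat_ext => /=; ring. Qed.
Lemma oneq_neq0 : realq 1 != 0.
Proof. by apply/eqP => -[] /eqP; rewrite oner_eq0. Qed.

HB.instance Definition _ := GRing.Zmodule_isNzRing.Build (quat R)
  mulqA mul1q mulq1 mulqDl mulqDr oneq_neq0.

Definition conjq q := Quat (q0 q) (- q1 q) (- q2 q) (- q3 q).

End QuatRing.

Definition conjqmx (R : realType) m n (A : 'M[quat R]_(m, n)) := map_mx (@conjq R) A.
Definition adjqmx (R : realType) m n (A : 'M[quat R]_(m, n)) := (conjqmx A)^T.

Definition right_eigenvalue (R : realType) n (A : 'M[quat R]_n) (lambda : quat R) :=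
  exists2 x : 'cV[quat R]_n, x != 0 & A *m x = map_mx (fun t => t * lambda) x.

Definition unitary_qmx (R : realType) n (U : 'M[quat R]_n) := adjqmx U *m U = 1%:M.

Definition real_diag (R : realType) n (l : n.-tuple R) : 'M[quat R]_n :=
  diag_mx (\row_i realq (tnth l i)).

(* [l] lists the right eigenvalues of the Hermitian matrix [A] with
   multiplicity.  [right_eigenvaluesP] and [right_eigenvalues_uniq] below show
   that the entries of [l] are exactly the right eigenvalues of [A], and that
   [A] determines [l]. *)
Definition right_eigenvalues (R : realType) n (A : 'M[quat R]_n) (l : n.-tuple R) :=
  sorted (fun a b => b <= a) l /\
  exists2 U : 'M[quat R]_n, unitary_qmx U & adjqmx U *m A *m U = real_diag l.

Definition Z_I (R : realType) (b c : quat R) : 'M[quat R]_3 :=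
  \matrix_(i < 3, j < 3)
    nth 0 (nth [::] [:: [:: 0;   0;   c];
                        [:: 0;   0;   b];
                        [:: - c; - b; 0]] i) j.

Definition Z_II (R : realType) (b c : quat R) : 'M[quat R]_3 :=
  \matrix_(i < 3, j < 3)
    nth 0 (nth [::] [:: [:: 0;   1;   c];
                        [:: -1;  0;   b];
                        [:: - c; - b; 0]] i) j.

Section Facts.
Variable R : realType.
Implicit Types p q : quat R.

Lemma q0D p q : q0 (p + q) = q0 p + q0 q. Proof. by []. Qed.

Lemma q0_sum I (s : seq I) P (F : I -> quat R) :
  q0 (\sum_(i <- s | P i) F i) = \sum_(i <- s | P i) q0 (F i).
Proof. by apply: (big_morph (@q0 R)) => // ? ?. Qed.

Lemma q0_mulC p q : q0 (p * q) = q0 (q * p).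
Proof. by rewrite /GRing.mul /=; ring. Qed.

Definition sqnorm q := q0 (conjq q * q).

Lemma sqnormE q : sqnorm q = q0 q ^+ 2 + q1 q ^+ 2 + q2 q ^+ 2 + q3 q ^+ 2.
Proof. by rewrite /sqnorm /GRing.mul /=; ring. Qed.

Lemma sqnorm_ge0 q : 0 <= sqnorm q.
Proof. by rewrite sqnormE !addr_ge0 ?sqr_ge0. Qed.

Lemma sqnorm_eq0 q : sqnorm q = 0 -> q = 0.
Proof.
rewrite sqnormE => /eqP; rewrite !paddr_eq0 ?addr_ge0 ?sqr_ge0 // !sqrf_eq0.
by case/andP=> /andP[/andP[/eqP h0 /eqP h1] /eqP h2] /eqP h3; apply: quat_ext.
Qed.

Lemma conjqK : involutive (@conjq R).
Proof. by move=> q; apply: quat_ext; rewrite /= ?opprK. Qed.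

Lemma conjqM p q : conjq (p * q) = conjq q * conjq p.
Proof. by apply: quat_ext; rewrite /GRing.mul /=; ring. Qed.

Lemma conjq_sum I (s : seq I) P (F : I -> quat R) :
  conjq (\sum_(i <- s | P i) F i) = \sum_(i <- s | P i) conjq (F i).
Proof.
apply: (big_morph (@conjq R)) => [p q|]; apply: quat_ext;
  by rewrite /= ?opprD ?oppr0.
Qed.

Lemma adjqmxM m n k (A : 'M[quat R]_(m, n)) (B : 'M[quat R]_(n, k)) :
  adjqmx (A *m B) = adjqmx B *m adjqmx A.
Proof.
apply/matrixP => i j; rewrite !mxE conjq_sum; apply: eq_bigr => t _.
by rewrite !mxE conjqM.
Qed.

Lemma adjqmxK m n (A : 'M[quat R]_(m, n)) : adjqmx (adjqmx A) = A.
Proof. by apply/matrixP => i j; rewrite !mxE conjqK. Qed.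

Lemma q0_trC m n (A : 'M[quat R]_(m, n)) (B : 'M[quat R]_(n, m)) :
  q0 (\tr (A *m B)) = q0 (\tr (B *m A)).
Proof.
rewrite /mxtrace !q0_sum.
under eq_bigr do rewrite mxE q0_sum.
under [RHS]eq_bigr do rewrite mxE q0_sum.
rewrite exchange_big; apply: eq_bigr => j _; apply: eq_bigr => i _.
exact: q0_mulC.
Qed.

Lemma q0_tr_adj m n (A : 'M[quat R]_(m, n)) :
  q0 (\tr (adjqmx A *m A)) = \sum_j \sum_i sqnorm (A i j).
Proof.
rewrite /mxtrace q0_sum; apply: eq_bigr => j _; rewrite mxE q0_sum.
by apply: eq_bigr => i _; rewrite !mxE.
Qed.

Lemma unitary_qmxC n (U : 'M[quat R]_n) : unitary_qmx U -> U *m adjqmx U = 1%:M.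
Proof.
move=> uU; pose Q := 1%:M - U *m adjqmx U.
have idQ : Q *m Q = Q.
  rewrite {2}/Q mulmxBr mulmx1 /Q mulmxBl mul1mx.
  by rewrite mulmxA -(mulmxA U) uU mulmx1 subrr subr0.
have hQ : adjqmx Q = Q.
  have adjB (A B : 'M[quat R]_n) : adjqmx (A - B) = adjqmx A - adjqmx B.
    by apply/matrixP => i j; rewrite !mxE; apply: quat_ext => //=; rewrite opprD.
  rewrite /Q adjB adjqmxM adjqmxK; congr (_ - _).
  by apply/matrixP => i j; rewrite !mxE eq_sym; case: eqP => _;
    apply: quat_ext; rewrite //= oppr0.
have : q0 (\tr (adjqmx Q *m Q)) = 0.
  have q0_trB (A B : 'M[quat R]_n) : q0 (\tr (A - B)) = q0 (\tr A) - q0 (\tr B).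
    by rewrite /mxtrace !q0_sum -sumrB; apply: eq_bigr => i _; rewrite !mxE.
  rewrite hQ idQ /Q q0_trB.
  by rewrite (q0_trC U) uU subrr.
rewrite q0_tr_adj => /eqP; rewrite psumr_eq0; last first.
  by move=> j _; apply: sumr_ge0 => i _; exact: sqnorm_ge0.
move=> /allP hz; have Q0 : Q = 0.
  apply/matrixP => i j; rewrite [RHS]mxE; apply: sqnorm_eq0; apply/eqP.
  have := hz j (mem_index_enum j).
  rewrite /= psumr_eq0; last by move=> t _; exact: sqnorm_ge0.
  by move/allP/(_ i (mem_index_enum i)).
by apply/esym/eqP; rewrite -subr_eq0 -/Q Q0.
Qed.

Lemma realq_comm (a : R) q : realq a * q = q * realq a.
Proof. by apply: quat_ext; rewrite /GRing.mul /=; ring. Qed.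

Lemma realq_div (a : R) lambda q : q != 0 ->
  realq a * q = q * lambda -> lambda = realq a.
Proof.
move=> q_neq0; rewrite realq_comm => /(congr1 (fun t => conjq q * t)).
rewrite !mulrA => h; have n_neq0 : sqnorm q != 0.
  by apply: contraNneq q_neq0 => /sqnorm_eq0 ->.
have nE : conjq q * q = realq (sqnorm q).
  by rewrite sqnormE; apply: quat_ext; rewrite /GRing.mul /=; ring.
rewrite nE in h; have iE : realq (sqnorm q)^-1 * realq (sqnorm q) = 1.
  by apply: quat_ext; rewrite /= ?mulVf //; rewrite /GRing.one /=; ring.
by rewrite -[lambda]mul1r -iE -mulrA -h mulrA iE mul1r.
Qed.

Lemma map_mulr_mulmx m n (B : 'M[quat R]_(m, n)) (x : 'cV[quat R]_n) lambda :
  B *m map_mx (fun t => t * lambda) x = map_mx (fun t => t * lambda) (B *m x).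
Proof.
apply/matrixP => i j; rewrite !mxE mulr_suml; apply: eq_bigr => t _.
by rewrite mxE mulrA.
Qed.

Lemma right_eigenvaluesP n (A : 'M[quat R]_n) (l : n.-tuple R) lambda :
  right_eigenvalues A l ->
  right_eigenvalue A lambda <-> exists i, lambda = realq (tnth l i).
Proof.
case=> _ [U uU dU]; have uU' := unitary_qmxC uU.
have AU : A *m U = U *m real_diag l.
  by rewrite -dU !mulmxA uU' mul1mx.
have AU' : adjqmx U *m A = real_diag l *m adjqmx U.
  by rewrite -dU -!mulmxA uU' mulmx1.
split=> [[x x_neq0 Ax]|[i ->]].
  have /cV0Pn[i yi_neq0] : adjqmx U *m x != 0.
    apply: contra_neq x_neq0 => y0.
    by rewrite -[x]mul1mx -uU' -mulmxA y0 mulmx0.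
  exists i; apply: (realq_div yi_neq0).
  have := congr1 (fun M => (adjqmx U *m M) i 0) Ax.
  rewrite /= mulmxA AU' -mulmxA map_mulr_mulmx.
  by rewrite mul_diag_mx !mxE.
exists (U *m delta_mx i 0).
  apply/eqP => /(congr1 (mulmx (adjqmx U))).
  rewrite mulmxA uU mul1mx mulmx0 => /matrixP/(_ i 0); rewrite !mxE !eqxx /=.
  by move/eqP; rewrite oner_eq0.
rewrite mulmxA AU -mulmxA -map_mulr_mulmx; congr (_ *m _).
rewrite mul_diag_mx; apply/matrixP => j k; rewrite !mxE.
case: (j =P i) => [->|_] /=; first exact: realq_comm.
by rewrite mulr0 mul0r.
Qed.

Lemma right_eigenvalues_uniq n (A : 'M[quat R]_n) (l l' : n.-tuple R) :
  right_eigenvalues A l -> right_eigenvalues A l' -> l = l'.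
Proof.
case=> sl [U uU dU] [sl' [U' uU' dU']].
pose V := adjqmx U' *m U.
have uV : adjqmx V *m V = 1%:M.
  rewrite /V adjqmxM adjqmxK !mulmxA -(mulmxA (adjqmx U)).
  by rewrite unitary_qmxC // mulmx1 uU.
have uVt : V *m adjqmx V = 1%:M by exact: unitary_qmxC.
have VE i j : V i j != 0 -> tnth l' i = tnth l j.
  move=> Vij; have VD : V *m real_diag l = real_diag l' *m V.
    rewrite -dU -dU' /V !mulmxA -(mulmxA (adjqmx U') U) unitary_qmxC // mulmx1.
    by rewrite -(mulmxA (adjqmx U' *m A) U') unitary_qmxC // mulmx1.
  clearbody V; have := congr1 (fun M : 'M_n => M i j) VD.
  rewrite /= mul_mx_diag mul_diag_mx !mxE => h.
  by have := realq_div Vij (esym h); case.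
clearbody V.
have col j : \sum_i sqnorm (V i j) = 1.
  have := congr1 (fun M : 'M_n => q0 (M j j)) uV.
  rewrite /= mxE q0_sum mxE eqxx => h; rewrite -[RHS]/(q0 (1 : quat R)) -h.
  by apply: eq_bigr => i _; rewrite !mxE.
have row i : \sum_j sqnorm (V i j) = 1.
  have := congr1 (fun M : 'M_n => q0 (M i i)) uVt.
  rewrite /= mxE q0_sum mxE eqxx => h; rewrite -[RHS]/(q0 (1 : quat R)) -h.
  by apply: eq_bigr => j _; rewrite !mxE q0_mulC.
have cE (t : n.-tuple R) a :
    count_mem a t = (\sum_(i < n) (tnth t i == a))%N.
  by rewrite -sum1_count big_tuple -big_mkcond.
have pl : perm_eq l l'.
  apply/allP => a _ /=; rewrite -(eqr_nat R) !cE !natr_sum.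
  apply/eqP; transitivity (\sum_j \sum_i (tnth l j == a)%:R * sqnorm (V i j)).
    by apply: eq_bigr => j _; rewrite -mulr_sumr col mulr1.
  rewrite exchange_big; apply: eq_bigr => i _ /=.
  rewrite -[RHS]mulr1 -(row i) mulr_sumr; apply: eq_bigr => j _.
  have [V0|/VE -> //] := eqVneq (V i j) 0.
  by rewrite V0 sqnormE /= !expr0n /= !addr0 !mulr0.
apply/val_inj/(sorted_eq _ _ sl sl' pl) => [y x z /= h1 h2|x y /=].
  exact: le_trans h2 h1.
by rewrite andbC => /le_anti.
Qed.

End Facts.

(* Main.v *)
(* A quaternion matrix has a right eigenvalue because H^n is a complex vector
   space C^(2n); for a Hermitian matrix this eigenvalue is real, and reflecting
   its unit eigenvector onto the first basis vector splits off a diagonal entry,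
   so every Hermitian matrix is unitarily diagonalizable.
   In case (i), Z Z* Z = a Z and Re tr (Z Z* ) = 2 a for an explicit real a > 0,
   so that the eigenvalues lie in {0, a} and add up to 2 a.
   In case (ii), the kernel of Z* is trivial: solving its first two equations
   for the first two coordinates turns the third one into
   (conj b conj c - conj c conj b) x_3 = 0.
   For (iii), b = i and c = (7/2) j give the eigenvalues 49/4, 16 and 1/4. *)
From HB Require Import structures.
Require Import Defs.
From mathcomp Require Import all_boot all_order all_algebra perm.
From mathcomp Require Import ring lra.
From mathcomp Require Import reals complex.

Set Implicit Arguments.
Unset Strict Implicit.
Unset Printing Implicit Defensive.

Import Order.TTheory GRing.Theory Num.Theory.
Local Open Scope ring_scope.

(** * Quaternion arithmetic and the norm *)

Section Quaternions.
Variable R : realType.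
Implicit Types (p q : quat R) (a : R).

Lemma mulqE p q : p * q = Defs.mulq p q.
Proof. by []. Qed.

Lemma realqM a a' : realq (a * a') = realq a * realq a'.
Proof. by apply: quat_ext; rewrite !mulqE /=; ring. Qed.

Lemma realqD a a' : realq (a + a') = realq a + realq a'.
Proof. by apply: quat_ext; rewrite /= ?addr0. Qed.

Lemma realqN a : realq (- a) = - realq a.
Proof. by apply: quat_ext; rewrite /= ?oppr0. Qed.

Lemma realq_inj : injective (@realq R).
Proof. by move=> a a' []. Qed.

Lemma conj_realq a : conjq (realq a) = realq a.
Proof. by apply: quat_ext; rewrite /= ?oppr0. Qed.

Lemma conjq0 : conjq 0 = 0 :> quat R.
Proof. by apply: quat_ext; rewrite /= ?oppr0. Qed.

Lemma conjq1 : conjq 1 = 1 :> quat R.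
Proof. exact: conj_realq. Qed.

Lemma conjqN q : conjq (- q) = - conjq q.
Proof. exact: quat_ext. Qed.

Lemma mulq_conj q : q * conjq q = realq (sqnorm q).
Proof. by rewrite sqnormE; apply: quat_ext; rewrite !mulqE /=; ring. Qed.

Lemma conj_mulq q : conjq q * q = realq (sqnorm q).
Proof. by rewrite sqnormE; apply: quat_ext; rewrite !mulqE /=; ring. Qed.

Lemma sqnormM p q : sqnorm (p * q) = sqnorm p * sqnorm q.
Proof. by rewrite !sqnormE ?mulqE /=; ring. Qed.

Lemma sqnorm_realq a : sqnorm (realq a) = a ^+ 2.
Proof. by rewrite sqnormE /=; ring. Qed.

Lemma sqnorm_gt0 q : q != 0 -> 0 < sqnorm q.
Proof.
move=> q_neq0; rewrite lt_neqAle sqnorm_ge0 andbT eq_sym.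
by apply: contra_neq q_neq0 => /sqnorm_eq0.
Qed.

(** The norm is multiplicative and vanishes only at 0, so there are no zero divisors. *)
Lemma mulq_eq0 p q : p * q = 0 -> p != 0 -> q = 0.
Proof.
move=> pq0 p_neq0; have : sqnorm (p * q) = 0.
  by rewrite pq0 sqnormE /=; ring.
rewrite sqnormM => /eqP; rewrite mulf_eq0 gt_eqF ?sqnorm_gt0 //=.
by move/eqP/sqnorm_eq0.
Qed.

End Quaternions.

(** * Conjugate transposes *)

Section AdjointMatrices.
Variable R : realType.
Implicit Types (q : quat R).

Lemma adjqmxB m n (A B : 'M[quat R]_(m, n)) :
  adjqmx (A - B) = adjqmx A - adjqmx B.
Proof. by apply/matrixP => i j; rewrite !mxE; apply: quat_ext; rewrite //= opprD. Qed.

Lemma adjqmx0 m n : adjqmx 0 = 0 :> 'M[quat R]_(m, n).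
Proof. by rewrite -[X in adjqmx X](subrr 0) adjqmxB subrr. Qed.

Lemma adjqmx_scalar n q : adjqmx (q%:M : 'M[quat R]_n) = (conjq q)%:M.
Proof.
apply/matrixP => i j; rewrite !mxE eq_sym; case: eqP => _ //=.
by apply: quat_ext; rewrite /= ?oppr0.
Qed.

Lemma adjqmx1 n : adjqmx 1%:M = 1%:M :> 'M[quat R]_n.
Proof. by rewrite adjqmx_scalar -[in LHS]/(realq 1) conj_realq. Qed.

Lemma adj_delta m n (i : 'I_m) (j : 'I_n) :
  adjqmx (delta_mx i j : 'M[quat R]_(m, n)) = delta_mx j i.
Proof.
apply/matrixP => k l; rewrite !mxE andbC.
by case: (_ && _); apply: quat_ext; rewrite /= ?oppr0.
Qed.

End AdjointMatrices.

(** * Existence of a right eigenvalue *)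

Section RightEigenvalue.
Variable R : realType.
Local Notation C := R[i]%type.

(* H^n is C^n + j C^n, a right vector space over C, and left multiplication by
   a quaternion matrix commutes with right multiplication by C. *)
Definition quat_of_cpair (u w : C) : quat R :=
  Quat (complex.Re u) (complex.Im u) (complex.Re w) (- complex.Im w).

Definition col_of_crow n (v : 'rV[C]_(n + n)) : 'cV[quat R]_n :=
  \col_i quat_of_cpair (v 0 (lshift n i)) (v 0 (rshift n i)).

(** The sign in front of [q3] comes from j i = -k. *)
Definition crow_of_col n (x : 'cV[quat R]_n) : 'rV[C]_(n + n) :=
  row_mx (\row_i Complex (q0 (x i 0)) (q1 (x i 0)))
         (\row_i Complex (q2 (x i 0)) (- q3 (x i 0))).

Lemma col_of_crowK n : cancel (@col_of_crow n) (@crow_of_col n).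
Proof.
move=> v; apply/rowP => i; rewrite mxE.
by case: splitP => j ij; rewrite !mxE /= ?opprK;
  [rewrite (_ : i = lshift n j)|rewrite (_ : i = rshift n j)];
  [case: (v 0 _)|exact: val_inj|case: (v 0 _)|exact: val_inj].
Qed.

Lemma crow_of_colK n : cancel (@crow_of_col n) (@col_of_crow n).
Proof.
move=> x; apply/colP => i; rewrite mxE row_mxEl row_mxEr !mxE.
by apply: quat_ext; rewrite /= ?opprK.
Qed.

Lemma col_of_crowD n : {morph @col_of_crow n : u v / u + v}.
Proof.
move=> u v; apply/colP => i; rewrite !mxE.
move: (u 0 _) (u 0 _) (v 0 _) (v 0 _) => [a b] [c d] [e f] [g h].
by apply: quat_ext => //=; rewrite opprD.
Qed.

(** Since (u + j w) z = u z + j (w z), complex scalars act by right multiplication with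
    [quat_of_cpair z 0], which is z as a quaternion. *)
Lemma col_of_crowZ n z (v : 'rV[C]_(n + n)) :
  col_of_crow (z *: v) = map_mx (fun t => t * quat_of_cpair z 0) (col_of_crow v).
Proof.
apply/colP => i; rewrite !mxE.
move: z (v 0 _) (v 0 _) => [a b] [c d] [e f].
by apply: quat_ext; rewrite !mulqE /=; ring.
Qed.

Definition lmulq n (A : 'M[quat R]_n) (v : 'rV[C]_(n + n)) :=
  crow_of_col (A *m col_of_crow v).

Lemma lmulq_is_linear n (A : 'M[quat R]_n) : linear (lmulq A).
Proof.
move=> z u v; apply: (can_inj (@col_of_crowK n)).
by rewrite col_of_crowD col_of_crowZ !crow_of_colK col_of_crowD mulmxDr
           col_of_crowZ map_mulr_mulmx.
Qed.

HB.instance Definition _ n (A : 'M[quat R]_n) :=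
  GRing.isLinear.Build C 'rV[C]_(n + n) 'rV[C]_(n + n) _ (lmulq A)
    (lmulq_is_linear A).

(** The characteristic polynomial of the complex matrix of A has degree 2n + 2 > 0, hence a complex
    root; an eigenvector for it is read back as a quaternion column. *)
Lemma right_eigenvalue_exists n (A : 'M[quat R]_n.+1) :
  exists lambda, right_eigenvalue A lambda.
Proof.
pose M := lin1_mx (lmulq A).
have /closed_rootP[z] : size (char_poly M) != 1 by rewrite size_char_poly.
rewrite -eigenvalue_root_char => /eigenvalueP[v vM v_neq0].
exists (quat_of_cpair z 0); exists (col_of_crow v).
  apply: contra_neq v_neq0 => v0; rewrite -(col_of_crowK v) v0.
  by rewrite -(col_of_crowK 0); congr crow_of_col; apply/colP => i;
     rewrite !mxE; apply: quat_ext; rewrite //= oppr0.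
by rewrite -col_of_crowZ -vM mul_rV_lin1 /= crow_of_colK.
Qed.

End RightEigenvalue.

(** * Unitary diagonalization of Hermitian matrices *)

Section Spectral.
Variable R : realType.
Implicit Types (q : quat R) (a : R).

Lemma map_mulr_mx m (x : 'cV[quat R]_m) q :
  map_mx (fun t => t * q) x = x *m q%:M.
Proof. by apply/matrixP => i j; rewrite !mxE big_ord1 !mxE !ord1 eqxx. Qed.

Definition colnorm m (x : 'cV[quat R]_m) : R := \sum_i sqnorm (x i 0).

Lemma adj_mul_col m (x : 'cV[quat R]_m) : adjqmx x *m x = (realq (colnorm x))%:M.
Proof.
apply/matrixP => i j; rewrite !ord1 !mxE eqxx /= /colnorm.
rewrite (big_morph _ (@realqD R) (erefl (realq 0))).
by apply: eq_bigr => k _; rewrite !mxE conj_mulq.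
Qed.

Lemma colnorm_ge0 m (x : 'cV[quat R]_m) : 0 <= colnorm x.
Proof. by apply: sumr_ge0 => i _; exact: sqnorm_ge0. Qed.

Lemma colnorm_eq0 m (x : 'cV[quat R]_m) : colnorm x = 0 -> x = 0.
Proof.
move/eqP; rewrite psumr_eq0 => [/allP h|i _]; last exact: sqnorm_ge0.
apply/colP => i; rewrite [RHS]mxE; apply/sqnorm_eq0/eqP.
exact: h (mem_index_enum i).
Qed.

Lemma colnorm_gt0 m (x : 'cV[quat R]_m) : x != 0 -> 0 < colnorm x.
Proof.
move=> x_neq0; rewrite lt_neqAle colnorm_ge0 andbT eq_sym.
by apply: contra_neq x_neq0 => /colnorm_eq0.
Qed.

(** The scalar x* A x = |x|^2 lambda equals its own conjugate, and |x|^2 > 0, so lambda has no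
    imaginary part. *)
Lemma hermitian_eigenvalue_real n (A : 'M[quat R]_n) (lambda : quat R) :
  adjqmx A = A -> right_eigenvalue A lambda -> exists a, lambda = realq a.
Proof.
move=> hA [x x_neq0 Ax]; exists (q0 lambda).
have h : adjqmx x *m A *m x = (realq (colnorm x) * lambda)%:M.
  by rewrite -mulmxA Ax map_mulr_mx mulmxA adj_mul_col -scalar_mxM.
have := congr1 (@adjqmx R _ _) h.
rewrite !adjqmxM adjqmxK hA mulmxA h adjqmx_scalar => /matrixP/(_ 0 0).
rewrite !mxE !eqxx /= !mulr1n.
move: (colnorm_gt0 x_neq0) => N0.
case: lambda {Ax h} => a b c d; rewrite mulqE /= => -[] hb hc hd.
have aux t : colnorm x * t = - (colnorm x * t) -> t = 0.
  by move=> ht; apply: (mulfI (negbT (gt_eqF N0))); rewrite mulr0; lra.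
by apply: quat_ext => //=; apply: aux; lra.
Qed.

(** The Householder reflection I - 2 w w* / |w|^2; it is the identity for w = 0. *)
Definition reflqmx n (w : 'cV[quat R]_n) : 'M[quat R]_n :=
  1%:M - w *m (realq (2 / colnorm w))%:M *m adjqmx w.

Lemma adj_reflqmx n (w : 'cV[quat R]_n) : adjqmx (reflqmx w) = reflqmx w.
Proof.
by rewrite /reflqmx adjqmxB adjqmx1 !adjqmxM adjqmxK adjqmx_scalar conj_realq mulmxA.
Qed.

Lemma reflqmx_invol n (w : 'cV[quat R]_n) : reflqmx w *m reflqmx w = 1%:M.
Proof.
rewrite /reflqmx; set k := 2 / _; set P := w *m _ *m _.
(* The subtracted part satisfies P^2 = 2 P, because k |w|^2 k = 2 k. *)
suff PP : P *m P = P + P.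
  by rewrite mulmxBr mulmx1 mulmxBl mul1mx PP opprB addrK subrK.
have -> : P + P = w *m ((realq k)%:M + (realq k)%:M) *m adjqmx w.
  by rewrite mulmxDr mulmxDl.
have -> : P *m P = w *m ((realq k)%:M *m (adjqmx w *m w) *m (realq k)%:M) *m adjqmx w.
  by rewrite !mulmxA.
rewrite adj_mul_col -!scalar_mxM -raddfD /= -!realqM -realqD.
suff -> : k * colnorm w * k = k + k by [].
rewrite /k.
(* If [colnorm w] is 0, then k = 2 / 0 = 0 and both sides vanish. *)
by have [->|N0] := eqVneq (colnorm w) 0; [rewrite invr0; ring|field].
Qed.

(** Right multiplication by the conjugate of a nonzero first entry makes that entry real; the norm
    is then divided out. The reflection below needs this real entry. *)
Lemma normalize_col n (x : 'cV[quat R]_n.+1) : x != 0 ->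
  exists t a, colnorm (x *m t%:M) = 1 /\ (x *m t%:M) 0 0 = realq a.
Proof.
move=> x_neq0.
have [u u0 [r xu]] : exists2 u, u != 0 & exists r, x 0 0 * u = realq r.
  have [x0|x0] := eqVneq (x 0 0) 0.
    by exists 1; [rewrite oner_eq0|exists 0; rewrite x0 mul0r].
  exists (conjq (x 0 0)); last by exists (sqnorm (x 0 0)); exact: mulq_conj.
  by apply: contra_neq x0 => cx0; rewrite -[x 0 0]conjqK cx0 conjq0.
pose s := Num.sqrt (colnorm x * sqnorm u).
have xu0 : 0 < colnorm x * sqnorm u by rewrite mulr_gt0 ?colnorm_gt0 ?sqnorm_gt0.
exists (u * realq s^-1), (r / s); split; last first.
  by rewrite -map_mulr_mx mxE mulrA xu realqM.
rewrite -map_mulr_mx /colnorm.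
under eq_bigr do rewrite mxE sqnormM.
rewrite -mulr_suml sqnormM sqnorm_realq -/(colnorm x) mulrA exprVn sqr_sqrtr ?ltW //.
by rewrite divff ?gt_eqF.
Qed.

(* The Householder reflection along y - e_0 exchanges e_0 and the unit vector y,
   provided that their inner product is real. *)
Lemma reflqmx_delta n (y : 'cV[quat R]_n.+1) a :
  colnorm y = 1 -> y 0 0 = realq a ->
  reflqmx (y - delta_mx 0 0) *m delta_mx 0 0 = y.
Proof.
move=> y1 y0; set e := delta_mx 0 0; set w := y - e.
have adje : adjqmx e = delta_mx 0 0 by exact: adj_delta.
have ey : adjqmx e *m y = (realq a)%:M.
  by rewrite adje -rowE; apply/matrixP => i j; rewrite !ord1 !mxE.
have ee : adjqmx e *m e = 1%:M.
  by rewrite adje mul_delta_mx; apply/matrixP => i j; rewrite !ord1 !mxE.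
have yy : adjqmx y *m y = 1%:M by rewrite adj_mul_col y1.
have ye : adjqmx y *m e = (realq a)%:M.
  by rewrite -(adjqmxK e) -adjqmxM ey adjqmx_scalar conj_realq.
have we : adjqmx w *m e = (realq (a - 1))%:M.
  by rewrite adjqmxB mulmxBl ye ee realqD realqN raddfB.
have wN : colnorm w = 2 * (1 - a).
  have h : adjqmx w *m w = (realq 1 - realq a - (realq a - realq 1))%:M.
    by rewrite adjqmxB mulmxBl !mulmxBr yy ye ey ee !raddfB.
  have := adj_mul_col w; rewrite h => /matrixP/(_ 0 0).
  rewrite !mxE eqxx !mulr1n => /(congr1 (@q0 R)) /= <-; ring.
rewrite /reflqmx mulmxBl mul1mx -!mulmxA we -scalar_mxM -realqM.
have [N0|N0] := eqVneq (colnorm w) 0.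
  have w0 := colnorm_eq0 N0.
  by rewrite w0 mul0mx subr0; apply/eqP; rewrite eq_sym -subr_eq0 -/w w0.
(* With |w|^2 = 2 (1 - a) the coefficient is -1, so e_0 goes to e_0 + w = y. *)
suff -> : 2 / colnorm w * (a - 1) = -1.
  by rewrite realqN raddfN /= mulmxN mulmx1 opprK /w addrC subrK.
by rewrite wN; field; move: N0; rewrite wN mulf_eq0 negb_or pnatr_eq0 /=.
Qed.

Lemma hermitian_diag n (A : 'M[quat R]_n) : adjqmx A = A ->
  exists2 U, unitary_qmx U &
    exists l : n.-tuple R, adjqmx U *m A *m U = real_diag l.
Proof.
elim: n A => [|n IHn] A hA.
  exists 1%:M; first by rewrite /unitary_qmx adjqmx1 mulmx1.
  by exists [tuple]; apply/matrixP => -[].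
have [lambda ev] := right_eigenvalue_exists A.
have [a aE] := hermitian_eigenvalue_real hA ev.
case: ev => x x0; rewrite map_mulr_mx {lambda}aE => Ax.
have [t [r [y1 y0]]] := normalize_col x0.
have /= He := reflqmx_delta y1 y0; set H := reflqmx _ in He.
set y := x *m t%:M in He.
have HH : H *m H = 1%:M := reflqmx_invol _.
have hH : adjqmx H = H := adj_reflqmx _.
(* A real eigenvalue commutes with the normalizing factor t, so y is still an eigenvector for a. *)
have Ay : A *m y = y *m (realq a)%:M.
  by rewrite mulmxA Ax -!mulmxA -!scalar_mxM realq_comm.
pose B : 'M[quat R]_(1 + n) := H *m A *m H.
have hB : adjqmx B = B by rewrite !adjqmxM hH hA mulmxA.
have Be : (B : 'M_n.+1) *m delta_mx 0 0 =
          delta_mx 0 0 *m (realq a)%:M :> 'cV[quat R]_n.+1.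
  have Hy : H *m y = delta_mx 0 0 by rewrite -He mulmxA HH mul1mx.
  by rewrite /B -mulmxA He -mulmxA Ay mulmxA Hy.
have BE : H *m A *m H = B by [].
clearbody B.
have hC : adjqmx (drsubmx B) = drsubmx B.
  by rewrite -[in RHS]hB; apply/matrixP => i j; rewrite !mxE.
have [V uV [l VCV]] := IHn _ hC.
(* The first column of B is a e_0 by [Be]; as B is Hermitian, this determines its first row too. *)
have B0 : B = block_mx (realq a)%:M 0 0 (drsubmx B).
  have Bi0 (i j : 'I_(1 + n)) : j = 0 :> nat ->
      B i j = if i == 0 :> nat then realq a else 0.
    move=> j0; have -> : j = ord0 by exact: val_inj.
    have := congr1 (fun M : 'cV_n.+1 => M i 0) Be.
    rewrite /= -colE !mxE big_ord1 !mxE !eqxx andbT /= => ->.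
    by rewrite -val_eqE /=; case: (_ == _); rewrite ?mul0r ?mul1r.
  have B0j (i j : 'I_(1 + n)) : i = 0 :> nat ->
      B i j = if j == 0 :> nat then realq a else 0.
    move=> i0; rewrite -hB mxE mxE Bi0 //; case: eqP => _; first exact: conj_realq.
    by apply: quat_ext; rewrite /= ?oppr0.
  rewrite -{1}[B]submxK; congr block_mx; apply/matrixP => i j; rewrite !mxE ?ord1.
  - by rewrite Bi0.
  - by rewrite B0j.
  - by rewrite Bi0.
pose V' : 'M[quat R]_(1 + n) := block_mx 1%:M 0 0 V.
have adjV' : adjqmx V' = block_mx 1%:M 0 0 (adjqmx V).
  rewrite /adjqmx /conjqmx map_block_mx tr_block_mx.
  by congr block_mx; [exact: adjqmx1|exact: adjqmx0|exact: adjqmx0].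
have uV' : adjqmx V' *m V' = 1%:M.
  rewrite adjV' /V' mulmx_block !mulmx1 !mulmx0 !mul0mx !addr0 !add0r uV.
  by rewrite -scalar_mx_block.
have dV' : adjqmx V' *m B *m V' = block_mx (realq a)%:M 0 0 (real_diag l).
  rewrite adjV' B0 /V' !mulmx_block.
  by rewrite !mulmx1 !mul1mx !mulmx0 !mul0mx !addr0 !add0r ?mul0mx VCV.
exists (H *m V').
  rewrite /unitary_qmx adjqmxM hH -mulmxA (mulmxA H) HH mul1mx.
  exact: uV'.
exists [tuple of a :: l].
have -> : adjqmx (H *m V') *m A *m (H *m V') = adjqmx V' *m B *m V'.
  by rewrite adjqmxM hH -BE !mulmxA.
rewrite dV' /real_diag; apply/matrixP => i j; rewrite [RHS]mxE mxE.
rewrite [in RHS]mxE (tnth_nth 0) -val_eqE /=.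
case: splitP => i' -> /=; rewrite mxE; case: splitP => j' -> /=; rewrite ?mxE ?ord1 //=.
by rewrite (tnth_nth 0).
Qed.

(** The diagonal entries are sorted, and the columns of U are permuted in the same way. *)
Lemma right_eigenvalues_exist n (A : 'M[quat R]_n) : adjqmx A = A ->
  exists l : n.-tuple R, right_eigenvalues A l.
Proof.
move=> /hermitian_diag[U uU [l UAU]].
pose l' := [tuple of sort >=%R l].
have /tuple_permP[s l'E] : perm_eq l' l by rewrite /= perm_sort.
have adjs : adjqmx (colsub s U) = rowsub s (adjqmx U).
  by apply/matrixP => i j; rewrite !mxE.
exists l'; split.
  by apply: sort_sorted => x y /=; exact: le_total.
exists (colsub s U).
  rewrite /unitary_qmx adjs mulmx_colsub mul_rowsub_mx uU.
  by apply/matrixP => i j; rewrite !mxE (inj_eq perm_inj).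
rewrite adjs mulmx_colsub !mul_rowsub_mx UAU; apply/matrixP => i j.
by rewrite !mxE (inj_eq perm_inj) (val_inj l'E : l' = _) tnth_mktuple.
Qed.

End Spectral.

(** * The forms (I) and (II) and the eigenvalues of Z Z* *)

Section SkewMatrices.
Variable R : realType.
Implicit Types (b c : quat R) (a : R).

Lemma adj_skew n (Z : 'M[quat R]_n) : Z^T = - Z -> adjqmx Z = - conjqmx Z.
Proof.
move=> sZ; apply/matrixP => i j.
have := congr1 (fun M : 'M_n => M i j) sZ; rewrite /= !mxE => ->.
exact: quat_ext.
Qed.

Lemma adj_mul_adj m n (Z : 'M[quat R]_(m, n)) :
  adjqmx (Z *m adjqmx Z) = Z *m adjqmx Z.
Proof. by rewrite adjqmxM adjqmxK. Qed.

Lemma Z_I_skew b c : (Z_I b c)^T = - Z_I b c.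
Proof.
apply/matrixP => -[[|[|[|//]]] ?] -[[|[|[|//]]] ?];
  by rewrite !mxE /= ?oppr0 ?opprK.
Qed.

Lemma Z_II_skew b c : (Z_II b c)^T = - Z_II b c.
Proof.
apply/matrixP => -[[|[|[|//]]] ?] -[[|[|[|//]]] ?];
  by rewrite !mxE /= ?oppr0 ?opprK.
Qed.

(** Every eigenvalue t satisfies t^2 = a t, so t is 0 or a; the sum 2 a and the decreasing order
    leave only a, a, 0. *)
Lemma right_eigenvalues_double (W : 'M[quat R]_3) a :
  0 < a -> adjqmx W = W -> W *m W = (realq a)%:M *m W -> q0 (\tr W) = 2 * a ->
  right_eigenvalues W [tuple a; a; 0].
Proof.
move=> a0 hW W2 trW; have [l evl] := right_eigenvalues_exist hW.
have [sl [U uU UWU]] := evl; have uU' := unitary_qmxC uU.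
have l2 i : tnth l i * tnth l i = a * tnth l i.
  have : adjqmx U *m (W *m W) *m U = adjqmx U *m (realq a)%:M *m W *m U.
    by rewrite W2 !mulmxA.
  have -> : adjqmx U *m (realq a)%:M = (realq a)%:M *m adjqmx U.
    by rewrite -!diag_const_mx; apply/matrixP => k j;
       rewrite mul_mx_diag mul_diag_mx !mxE realq_comm.
  have -> : adjqmx U *m (W *m W) *m U = real_diag l *m real_diag l.
    by rewrite -UWU !mulmxA -(mulmxA (_ *m W) U) uU' mulmx1.
  rewrite -!(mulmxA (realq a)%:M) UWU => /matrixP/(_ i i).
  rewrite -diag_const_mx !mul_diag_mx !mxE eqxx !mulr1n.
  by rewrite -!realqM => -[].
have trl : \sum_i tnth l i = 2 * a.
  (* The trace itself is not cyclic over the quaternions, but its real part is. *)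
  rewrite -trW -[W]mul1mx -uU' -mulmxA q0_trC UWU /mxtrace q0_sum.
  by apply: eq_bigr => i _; rewrite !mxE eqxx.
suff -> : [tuple a; a; 0] = l by [].
move: sl trl (l2 0) (l2 1) (l2 2%R); rewrite !big_ord_recl big_ord0 !(tnth_nth 0) /=.
case: l {evl UWU l2} => -[|x [|y [|z []]]] //= ? /and3P[yx zy _] s lx ly lz.
have root t : t * t = a * t -> t = 0 \/ t = a.
  move/eqP; rewrite -subr_eq0 -mulrBl mulf_eq0 subr_eq0.
  by case/orP => /eqP; [right|left].
have [xa [ya za]] : x = a /\ (y = a /\ z = 0).
  by case: (root x lx) (root y ly) (root z lz) => ? [] ? [] ?; split; lra.
by apply: val_inj; rewrite /= xa ya za.
Qed.

(** The i-th eigenvalue is the squared norm of Z* u_i, where u_i is the i-th column of U, and Z* u_i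
    is nonzero by injectivity. *)
Lemma right_eigenvalues_gt0 n (Z : 'M[quat R]_n) (l : n.-tuple R) :
  right_eigenvalues (Z *m adjqmx Z) l ->
  (forall x : 'cV_n, adjqmx Z *m x = 0 -> x = 0) -> forall i, 0 < tnth l i.
Proof.
move=> [_ [U uU UZU]] injZ i.
have : adjqmx (adjqmx Z *m col i U) *m (adjqmx Z *m col i U) = (realq (tnth l i))%:M.
  rewrite colE !adjqmxM adjqmxK !mulmxA.
  have -> : adjqmx (delta_mx i 0) *m adjqmx U *m Z *m adjqmx Z *m U =
          adjqmx (delta_mx i 0 : 'cV_n) *m real_diag l.
    by rewrite -UZU !mulmxA.
  rewrite adj_delta -!mulmxA mul_diag_mx -rowE.
  by apply/matrixP => k j; rewrite !ord1 !mxE eqxx mulr1.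
rewrite adj_mul_col => /matrixP/(_ 0 0); rewrite !mxE => -[<-].
apply: colnorm_gt0; apply/eqP => /injZ /(congr1 (mulmx (adjqmx U))).
rewrite mulmx0 colE mulmxA uU mul1mx => /matrixP/(_ i 0); rewrite !mxE !eqxx.
by move/eqP; rewrite oner_eq0.
Qed.

Lemma Z_I_cube b c : Z_I b c *m adjqmx (Z_I b c) *m Z_I b c =
   (realq (sqnorm b + sqnorm c))%:M *m Z_I b c.
Proof.
rewrite -diag_const_mx mul_diag_mx.
apply/matrixP => -[[|[|[|//]]] ?] -[[|[|[|//]]] ?].
all: rewrite !mxE !big_ord_recl !big_ord0 !mxE.
all: rewrite !big_ord_recl !big_ord0 !mxE /= ?(mul0r, mulr0, add0r, addr0).
all: by apply: quat_ext; rewrite ?mulqE ?sqnormE /=; ring.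
Qed.

Lemma Z_II_cube b c : conjq b * conjq c = conjq c * conjq b ->
  Z_II b c *m adjqmx (Z_II b c) *m Z_II b c =
   (realq (1 + sqnorm b + sqnorm c))%:M *m Z_II b c.
Proof.
rewrite !mulqE => -[] _ e1 e2 e3.
rewrite -diag_const_mx mul_diag_mx.
apply/matrixP => -[[|[|[|//]]] ?] -[[|[|[|//]]] ?].
all: rewrite !mxE !big_ord_recl !big_ord0 !mxE.
all: rewrite !big_ord_recl !big_ord0 !mxE /= ?(mul0r, mulr0, add0r, addr0).
(* Off the diagonal the entries agree identically. The diagonal ones are, up to sign, commutators of
   b or conj b with c or conj c, which are linear combinations of [e1], [e2], [e3]. *)
all: by apply: quat_ext; rewrite ?mulqE ?sqnormE /=; first [ring | lra].
Qed.

(** The real trace of Z Z* is the sum of the squared norms of the entries of Z, where b and c each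
    occur twice up to sign. *)
Lemma Z_I_trace b c :
  q0 (\tr (Z_I b c *m adjqmx (Z_I b c))) = 2 * (sqnorm b + sqnorm c).
Proof.
by rewrite q0_trC q0_tr_adj !big_ord_recl !big_ord0 !mxE /= !sqnormE /=; ring.
Qed.

Lemma Z_II_trace b c :
  q0 (\tr (Z_II b c *m adjqmx (Z_II b c))) = 2 * (1 + sqnorm b + sqnorm c).
Proof.
by rewrite q0_trC q0_tr_adj !big_ord_recl !big_ord0 !mxE /= !sqnormE /=; ring.
Qed.

(** Multiplying the cubic identity on the right by Z* gives W^2 = a W. *)
Lemma right_eigenvalues_cube (Z : 'M[quat R]_3) a : 0 < a ->
  Z *m adjqmx Z *m Z = (realq a)%:M *m Z ->
  q0 (\tr (Z *m adjqmx Z)) = 2 * a ->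
  right_eigenvalues (Z *m adjqmx Z) [tuple a; a; 0].
Proof.
move=> a0 Z3 trZ; apply: right_eigenvalues_double => //.
  exact: adj_mul_adj.
by rewrite mulmxA Z3 mulmxA.
Qed.

Lemma Z_II_adj_inj b c (x : 'cV_3) : conjq b * conjq c <> conjq c * conjq b ->
  adjqmx (Z_II b c) *m x = 0 -> x = 0.
Proof.
(* The indices have the form that [big_ord_recl] produces. *)
move=> bc Zx; pose x0 := x ord0 0; pose x1 := x (lift ord0 ord0) 0.
pose x2 := x (lift ord0 (lift ord0 ord0)) 0.
have [h0 h1 h2] : [/\ x1 = - (conjq c * x2), x0 = conjq b * x2 &
                     conjq c * x0 + conjq b * x1 = 0].
  move/matrixP: Zx => Zx; split.
  - have := Zx ord0 0.
    rewrite !mxE !big_ord_recl !big_ord0 !mxE /= -/x0 -/x1 -/x2.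
    rewrite conjq0 !conjqN conjq1 mul0r add0r addr0 mulN1r mulNr -opprD.
    by move/eqP; rewrite oppr_eq0 addr_eq0 => /eqP.
  - have := Zx (lift ord0 ord0) 0.
    rewrite !mxE !big_ord_recl !big_ord0 !mxE /= -/x0 -/x1 -/x2.
    rewrite conjq0 !conjqN conjq1 mul0r add0r addr0 mul1r mulNr.
    by move/eqP; rewrite subr_eq0 => /eqP.
  - have := Zx (lift ord0 (lift ord0 ord0)) 0.
    rewrite !mxE !big_ord_recl !big_ord0 !mxE /= -/x0 -/x1 -/x2.
    by rewrite conjq0 mul0r !addr0.
have z2 : x2 = 0.
  apply: (@mulq_eq0 _ (conjq c * conjq b - conjq b * conjq c)).
    by rewrite mulrBl -h2 h0 h1 mulrN !mulrA.
  by rewrite subr_eq0; apply/eqP => h; apply: bc.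
have z1 : x1 = 0 by rewrite h0 z2 mulr0 oppr0.
have z0 : x0 = 0 by rewrite h1 z2 mulr0.
apply/colP => -[[|[|[|//]]] ?]; rewrite [RHS]mxE.
- by rewrite -z0; congr (x _ _); exact: val_inj.
- by rewrite -z1; congr (x _ _); exact: val_inj.
- by rewrite -z2; congr (x _ _); exact: val_inj.
Qed.

Lemma mul_conj_skew n (Z : 'M[quat R]_n) : Z^T = - Z ->
  - (Z *m conjqmx Z) = Z *m adjqmx Z.
Proof. by move=> sZ; rewrite (adj_skew sZ) mulmxN. Qed.

Lemma Z_I_double b c : Z_I b c <> 0 ->
  exists2 a, 0 < a & right_eigenvalues (Z_I b c *m adjqmx (Z_I b c)) [tuple a; a; 0].
Proof.
(* A zero sum would force b = c = 0 and hence Z = 0. *)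
move=> Z0; have a0 : 0 < sqnorm b + sqnorm c.
  rewrite lt_neqAle addr_ge0 ?sqnorm_ge0 // andbT eq_sym paddr_eq0 ?sqnorm_ge0 //.
  apply/negP => /andP[/eqP/sqnorm_eq0 b0 /eqP/sqnorm_eq0 c0]; apply: Z0.
  by apply/matrixP => -[[|[|[|//]]] ?] -[[|[|[|//]]] ?]; rewrite !mxE /= ?b0 ?c0 ?oppr0.
exists (sqnorm b + sqnorm c) => //.
by apply: right_eigenvalues_cube => //; [exact: Z_I_cube|exact: Z_I_trace].
Qed.

Lemma Z_II_double b c : conjq b * conjq c = conjq c * conjq b ->
  exists2 a, 0 < a & right_eigenvalues (Z_II b c *m adjqmx (Z_II b c)) [tuple a; a; 0].
Proof.
move=> bc; have a0 : 0 < 1 + sqnorm b + sqnorm c.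
  by move: (sqnorm_ge0 b) (sqnorm_ge0 c); lra.
exists (1 + sqnorm b + sqnorm c) => //.
by apply: right_eigenvalues_cube => //; [exact: Z_II_cube|exact: Z_II_trace].
Qed.

Lemma Z_II_positive b c : conjq b * conjq c <> conjq c * conjq b ->
  exists2 l : 3.-tuple R,
    right_eigenvalues (Z_II b c *m adjqmx (Z_II b c)) l & forall i, 0 < tnth l i.
Proof.
move=> bc; have [l evl] := right_eigenvalues_exist (adj_mul_adj (Z_II b c)).
by exists l => //; apply: (right_eigenvalues_gt0 evl) => x; exact: Z_II_adj_inj.
Qed.

(* Conjugation by diag(1, -k, -i) turns W into the real matrix
   [[1 + t^2, t, 1], [t, 2, t], [1, t, 1 + t^2]]. *)
Lemma Z_II_eigen (t x y lambda : R) :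
  let Z := Z_II (Quat 0 1 0 0) (Quat 0 0 t 0) in
  1 + t ^+ 2 + t * x + y = lambda ->
  t + 2 * x + t * y = lambda * x ->
  1 + t * x + (1 + t ^+ 2) * y = lambda * y ->
  right_eigenvalue (Z *m adjqmx Z) (realq lambda).
Proof.
move=> Z e1 e2 e3.
(* This is diag(1, -k, -i) applied to (1, x, y), an eigenvector of the real matrix. *)
exists (\col_(i < 3) nth 0 [:: 1; Quat 0 0 0 (- x); Quat 0 (- y) 0 0] i).
  apply/eqP => /matrixP/(_ 0 0); rewrite !mxE /=.
  by move/eqP; rewrite oner_eq0.
rewrite -mulmxA; apply/matrixP => -[[|[|[|//]]] ?] j; rewrite !mxE.
all: rewrite !big_ord_recl !big_ord0 !mxE !big_ord_recl !big_ord0 !mxE /=.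
all: rewrite ?(mul0r, mulr0, add0r, addr0).
all: by apply: quat_ext; rewrite !mulqE /=; first [ring | lra].
Qed.

Lemma Z_II_distinct : exists b c,
  conjq b * conjq c <> conjq c * conjq b /\
  exists2 l : 3.-tuple R,
    right_eigenvalues (Z_II b c *m adjqmx (Z_II b c)) l &
    (forall i, 0 < tnth l i) /\ uniq l.
Proof.
(* One eigenvalue is t^2; the other two have sum 4 + t^2 and product 4, so they are rational once
   t^2 + 8 is a square, here (9/2)^2. *)
pose t : R := 7 / 2; exists (Quat 0 1 0 0), (Quat 0 0 t 0).
have bc : conjq (Quat 0 1 0 0) * conjq (Quat 0 0 t 0) <>
          conjq (Quat 0 0 t 0) * conjq (Quat 0 1 0 0).
  by rewrite !mulqE /= => -[]; rewrite /t; lra.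
split=> //; have [l evl l_gt0] := Z_II_positive bc; exists l => //; split=> //.
have meml lambda x y :
    1 + t ^+ 2 + t * x + y = lambda -> t + 2 * x + t * y = lambda * x ->
    1 + t * x + (1 + t ^+ 2) * y = lambda * y -> lambda \in tval l.
  move=> e1 e2 e3; have /(right_eigenvaluesP _ evl)[i /realq_inj ->] :=
    Z_II_eigen e1 e2 e3.
  exact: mem_tnth.
(* Three distinct values that all occur in a list of length 3 leave no room for a repetition. *)
apply: (@leq_size_uniq _ [:: 49 / 4; 16; 1 / 4]); last by rewrite size_tuple.
  by rewrite /= !inE !negb_or; apply/and3P; split=> //; [apply/andP; split|];
     apply/eqP; lra.
move=> lambda; rewrite !inE => /or3P[] /eqP ->.
(* The real eigenvectors are (1, 0, -1), (1, 1/2, 1) and (1, -4, 1). *)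
- by apply: (meml _ 0 (-1)); rewrite /t; field.
- by apply: (meml _ (1 / 2) 1); rewrite /t; field.
- by apply: (meml _ (- 4) 1); rewrite /t; field.
Qed.

End SkewMatrices.

Theorem theorem4p2 (R : realType) :
  (forall (b c : quat R) (Z : 'M[quat R]_3),
     Z <> 0 -> Z = Z_I b c \/ Z = Z_II b c ->
     let W := - (Z *m conjqmx Z) in
     [/\ W = Z *m adjqmx Z,
         (Z = Z_I b c \/
          Z = Z_II b c /\ conjq b * conjq c = conjq c * conjq b) ->
           exists2 a : R, 0 < a & right_eigenvalues W [tuple a; a; 0]
       & Z = Z_II b c /\ conjq b * conjq c <> conjq c * conjq b ->
           exists2 l : 3.-tuple R,
             right_eigenvalues W l & forall i, 0 < tnth l i])
  /\
  (exists b c : quat R,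
     conjq b * conjq c <> conjq c * conjq b /\
     let Z := Z_II b c in
     let W := - (Z *m conjqmx Z) in
     exists2 l : 3.-tuple R,
       right_eigenvalues W l & (forall i, 0 < tnth l i) /\ uniq l).
Proof.
split=> [b c Z Z0 ZE W|]; last first.
  have [b [c [bc evl]]] := Z_II_distinct R.
  by exists b, c; split=> // Z W; rewrite /W (mul_conj_skew (Z_II_skew b c)).
have WE : W = Z *m adjqmx Z.
  by apply: mul_conj_skew; case: ZE => ->; [exact: Z_I_skew|exact: Z_II_skew].
rewrite WE; split=> // [[ZI|[ZII bc]]|[-> bc]].
- by rewrite ZI in Z0 *; exact: Z_I_double.
- by rewrite ZII; exact: Z_II_double.
- exact: Z_II_positive.
Qed.
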